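(* Let $E$ be a finite-dimensional real inner-product space, let $U\subset E$ be a nonempty finite set with $0\in\operatorname{conv}U$, and let $A\colon E\to E$ be linear with $\langle Ax,x\rangle\ge\mu\|x\|^2$ for all $x\in E$, for some $\mu>0$. There are constants $C_{\mathrm w},C\ge1$, depending only on $E,U,A$, such that the following holds. Let $\overline w\ge0$, $B\ge0$, and suppose that for every integer $k\ge0$ $$z_{k+1}=z_k+w_ku_k,\quad 0\le w_k\le\overline w,\quad u_k\in U,\quad \langle Az_k,u_k\rangle\le\min_{u\in U}\langle Az_k,u\rangle+B .$$ For integers $T\ge1$ put $\Lambda_T:=\sum_{k=0}^{T-1}w_k$. Then for every $T\ge1$ with $\Lambda_T>0$, $$\Bigl\|\frac1{\Lambda_T}\sum_{k=0}^{T-1}w_ku_k\Bigr\|=\frac{\|z_T-z_0\|}{\Lambda_T}\le\frac{C_{\mathrm w}(\overline w+\|z_0\|+B)+\|z_0\|}{\Lambda_T}.$$ If $\lim_{T\to\infty}\Lambda_T=\infty$, the weighted averages $\frac1{\Lambda_T}\sum_{k=0}^{T-1}w_ku_k$ therefore converge to zero at rate $O(\Lambda_T^{-1})$; this is an $O(T^{-1})$ bound if there are $c>0$ and an integer $T_0\ge1$ with $\Lambda_T\ge cT$ for every integer $T\ge T_0$. If $w_k=1$ for all $k\ge0$, then $$\Bigl\|\frac1T\sum_{k=0}^{T-1}u_k\Bigr\|\le\frac{C(1+\|z_0\|+B)+\|z_0\|}{T}\qquad\text{for every integer }T\ge1.$$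
   Context: $\|\cdot\|$ is the norm induced by the inner product of $E$. In the paper, $C_{\mathrm w}$ is the constant in the uniform state bound $\sup_k\|z_k\|\le C_{\mathrm w}(\overline w+\|z_0\|+B)$ for such weighted recursions, and $C$ is the constant in the bound $\sup_k\|z_k\|\le C(1+\|z_0\|+B)$ for the unit-weight recursion. *)

(* Defs.v *)
From HB Require Import structures.
From mathcomp Require Export all_boot all_order all_algebra finmap.
From mathcomp Require Export all_classical all_reals all_analysis.
Export numFieldNormedType.Exports.

Set Implicit Arguments.
Unset Strict Implicit.
Unset Printing Implicit Defensive.

Import Order.TTheory GRing.Theory Num.Theory.
Local Open Scope classical_set_scope.
Local Open Scope ring_scope.

(* A finite-dimensional real inner-product space is a vectType over a realType
   with a positive definite symmetric bilinear form dot : {dot E for idfun}. *)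
Definition dnorm (R : realType) (E : vectType R) (dot : {dot E for idfun})
  (x : E) : R := Num.sqrt (dot x x).

Definition conv_hull (R : realType) (E : vectType R) (S : set E) : set E :=
  smallest (@convex_set R E) S.

(* The value of the fold on the empty set is the junk value f 0.*)
Definition fset_min (R : realType) (E : vectType R) (U : {fset E})
  (f : E -> R) : R := \big[Num.min/f (head 0 U)]_(u <- U) f u.

Lemma fset_minP (R : realType) (E : vectType R) (U : {fset E}) (f : E -> R) :
  U != fset0 ->
  (exists2 u, u \in U & fset_min U f = f u) /\
  (forall v, v \in U -> fset_min U f <= f v).
Proof.
move=> U0; have hU : head 0 U \in U by rewrite -nth0 mem_nth// cardfs_gt0.
split; last by move=> v vU; rewrite /fset_min; exact: ge_bigmin_seq.
rewrite /fset_min big_seq; elim/big_ind: _ => [|x y [a aU ->] [b bU ->]|u uU].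
- by exists (head 0 U).
- by rewrite minEle; case: ifP => _; [exists a|exists b].
- by exists u.
Qed.

Definition total_weight (R : realType) (w : nat -> R) (T : nat) : R :=
  \sum_(0 <= k < T) w k.

Definition weighted_avg (R : realType) (E : vectType R) (w : nat -> R)
  (u : nat -> E) (T : nat) : E :=
  (total_weight w T)^-1 *: \sum_(0 <= k < T) w k *: u k.

(* Main.v *)
From HB Require Import structures.
Require Import Defs.
From mathcomp Require Import ring lra.
Set Implicit Arguments.
Unset Strict Implicit.
Unset Printing Implicit Defensive.
Import Order.TTheory GRing.Theory Num.Theory.
Local Open Scope classical_set_scope.
Local Open Scope ring_scope.

(** Everything follows from one estimate: a path
    [z k.+1 = z k + w k *: u k] driven by nearly minimizing vectors [u k] of
    [<A (z k), .>] satisfies [|z k| <= C * D], where [D] bounds the steps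
    [w k], the slack in the minimization and [|z 0|]. The weighted average is
    [(z T - z 0) / total_weight w T], so the stated rates are then immediate.
    Write [a x y] for [<A x, y>]; this form is coercive and in general not
    symmetric, which rules out [a z z] as a Lyapunov function.

    In continuous time the function [max_u - a z u] decreases, since on a face
    where several [u] compete the averaged velocity [m] satisfies
    [a m u = a m m] for all of them, which is positive unless [m = 0]. The
    discrete path chatters between
    the vectors of a face, so the maximum is smoothed: for every nonempty set
    [S] of vectors a point [p_S] of the convex hull of [S] is fixed such that
    [a u p_S > 0] for every [u] in [S] and all weights of [p_S] are positive,
    or [p_S = 0] if the hull contains [0] ([balanced_point_exists], through
    Gordan's alternative). A step along [u] in [S] does not increase
    [- a z p_S]. Adding to [- a z p_S] a constant multiple of [D] that grows
    geometrically with [#|S|] makes sets [S] missing the chosen [u] dominated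
    by [u |: S] or by [[set u]] ([potential_dominated]); hence a common bound
    on all these potentials propagates along the path ([potential_path]).

    Two consequences are drawn. First, [a (z k) u >= - C * D] for all [u] and
    [k] ([greedy_lower_bound]). Second, if [0] is not in the convex hull then
    every [a u p_S] is bounded below, every step lowers the bound by a fixed
    multiple of its weight, and the total weight is at most [C * D]
    ([greedy_total_weight]).

    If [0] is interior to the convex hull, the first consequence bounds [z].
    In general call [u] recurrent if it has a positive coefficient in some
    nonnegative linear relation between the vectors, and let [L] be the span of
    the recurrent ones. The lower bounds imply [`|a (z k) u| <= C * D] for
    recurrent [u], which bounds the component of [z k] in [L]
    ([span_norm_bound]). The complementary component, taken orthogonally to
    [L] for [a], moves only when a vector outside [L] is chosen, again by a
    nearly minimizing rule; and [0] is not in the convex hull of the projected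
    vectors ([transient_independent]). The second consequence therefore bounds
    its total displacement ([state_bound]). *)

(** * Gordan's alternative *)

Lemma small_perturbation (R : realFieldType) (I : eqType) (s : seq I)
    (g h : I -> R) :
  (forall i, i \in s -> 0 < g i) ->
  exists2 e : R, 0 < e & forall i, i \in s -> 0 < g i - e * h i.
Proof.
elim: s => [|i0 s IHs] gs; first by exists 1.
have [i si|e e0 es] := IHs; first by apply: gs; rewrite inE si orbT.
have g0 : 0 < g i0 by apply: gs; rewrite mem_head.
pose d := g i0 / (1 + `|h i0|).
have d0 : 0 < d by rewrite divr_gt0// ltr_pwDl.
exists (Num.min e d); first by rewrite lt_min e0.
move=> i; rewrite inE => /predU1P[->|si].
  rewrite subr_gt0; apply: (@le_lt_trans _ _ (d * `|h i0|)).
    apply: (@le_trans _ _ (Num.min e d * `|h i0|)).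
      by rewrite ler_wpM2l ?ler_norm// le_min !ltW.
    by rewrite ler_wpM2r// ge_min lexx orbT.
  by rewrite /d mulrAC ltr_pdivrMr ?ltr_pwDl// ltr_pM2l// ltrDr.
have [hi|hi] := leP (h i) 0.
  by rewrite (lt_le_trans (gs i _)) ?inE ?si ?orbT// lerBrDr gerDl
     mulr_ge0_le0// le_min !ltW.
rewrite (lt_le_trans (es i si))// lerB// ler_wpM2r ?(ltW hi)// ge_min lexx//.
Qed.

(** By induction on the number of functionals: if a point [x] positive for the
    tail is negative for the head [i0], the tail functionals are composed with
    the projection along [x] onto the kernel of [f i0], and the alternative for
    them is lifted back. *)
Lemma gordan_seq (R : realFieldType) (V : lmodType R) (I : eqType)
    (s : seq I) (f : I -> V -> R) :
  uniq s -> (forall i, scalar (f i)) ->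
  (exists x, forall i, i \in s -> 0 < f i x) \/
  exists q : I -> R, [/\ forall i, 0 <= q i, exists2 i, i \in s & 0 < q i &
                         forall x, \sum_(i <- s) q i * f i x = 0].
Proof.
elim: s f => [|i0 s IHs] f /=; first by left; exists 0.
move=> /andP[i0s us] flin.
have f0 i : f i 0 = 0 by have := flin i 1 0 0; rewrite scale1r addr0; lra.
have fZ i c x : f i (c *: x) = c * f i x.
  by have := flin i c x 0; rewrite addr0 f0 addr0.
have fB i c x y : f i (y - c *: x) = f i y - c * f i x.
  by rewrite addrC -scaleNr flin mulNr addrC.
pose ext (c : R) (q : I -> R) i := if i == i0 then c else q i.
have ext_s c q i : i \in s -> ext c q i = q i.
  by move=> si; rewrite /ext ifN//; apply: contraNneq i0s => <-.
have ext_sum c q x :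
    \sum_(i <- i0 :: s) ext c q i * f i x
    = c * f i0 x + \sum_(i <- s) q i * f i x.
  rewrite big_cons {1}/ext eqxx; congr (_ + _).
  by apply: eq_big_seq => i /= si; rewrite ext_s.
have ext_ge0 c q : 0 <= c -> (forall i, 0 <= q i) -> forall i, 0 <= ext c q i.
  by move=> c0 q0 i; rewrite /ext; case: ifP.
have ext_gt0 c q : (exists2 i, i \in s & 0 < q i) ->
    exists2 i, i \in i0 :: s & 0 < ext c q i.
  by move=> [i si qi]; exists i; rewrite ?ext_s// inE si orbT.
have [[x xs]|[q [q0 qs qf]]] := IHs f us flin; last first.
  right; exists (ext 0 q); split; [exact: ext_ge0|exact: ext_gt0|].
  by move=> x; rewrite ext_sum qf mul0r addr0.
have [fx|fx] := ltP 0 (f i0 x).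
  by left; exists x => i; rewrite inE => /predU1P[->|/xs].
have [[y fy]|fy0] := pselect (exists y, 0 < f i0 y); last first.
  right; exists (ext 1 (fun=> 0)); split=> [||y].
  - by apply: ext_ge0.
  - by exists i0; rewrite ?mem_head// /ext eqxx.
  - rewrite ext_sum big1 ?addr0 ?mul1r => [|i _]; last by rewrite mul0r.
    apply/eqP; rewrite eq_le !leNgt; apply/andP; split; apply/negP => fy.
      by apply: fy0; exists y.
    by apply: fy0; exists (0 - 1 *: y); rewrite fB f0; lra.
(* tilting x away from y makes the sign at i0 strict *)
have {x xs fx}[x fx xs] : exists2 x, f i0 x < 0 &
    forall i, i \in s -> 0 < f i x.
  have [e e0 es] := small_perturbation (fun i => f i y) xs.
  exists (x - e *: y) => [|i si]; last by rewrite fB es.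
  by rewrite fB subr_lt0 (le_lt_trans fx)// mulr_gt0.
(* g i is f i after the projection along x onto the kernel of f i0 *)
pose g i z := f i (z - (f i0 z / f i0 x) *: x).
have glin i : scalar (g i).
  by move=> c z1 z2; rewrite /g !fB !flin; field; rewrite lt_eqF.
have [[z zs]|[q [q0 qs qg]]] := IHs g us glin.
  (* the projected point has value 0 at i0; subtracting a little x makes it
     positive there without losing the other signs *)
  left; have [e e0 es] := small_perturbation (fun i => f i x) zs.
  exists (z - (f i0 z / f i0 x) *: x - e *: x) => i.
  rewrite inE => /predU1P[->|si]; last by rewrite fB es.
  rewrite !fB divfK ?lt_eqF// subrr sub0r -mulrN mulr_gt0// oppr_gt0//.
right; exists (ext (- (\sum_(i <- s) q i * f i x) / f i0 x) q); split.
- apply: ext_ge0 => //; rewrite mulNr -mulrN -invrN divr_ge0 ?oppr_ge0 ?(ltW fx)//.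
  by rewrite big_seq sumr_ge0// => i si; rewrite mulr_ge0// ltW// xs.
- exact: ext_gt0.
- move=> z; rewrite ext_sum -[RHS](qg z).
  under [RHS]eq_bigr do rewrite /g fB mulrBr mulrCA.
  rewrite sumrB -mulr_sumr addrC; congr (_ + _).
  by field; rewrite lt_eqF.
Qed.

Lemma gordan (R : realFieldType) (V : lmodType R) (I : finType)
    (f : I -> V -> R) :
  (forall i, scalar (f i)) ->
  (exists x, forall i, 0 < f i x) \/
  exists q : I -> R, [/\ forall i, 0 <= q i, exists i, 0 < q i &
                         forall x, \sum_i q i * f i x = 0].
Proof.
move=> flin.
have [[x xf]|[q [q0 [i _ qi] qf]]] :=
    gordan_seq (index_enum_uniq I) flin.
  by left; exists x => i; apply: xf; rewrite mem_index_enum.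
by right; exists q; split=> //; exists i.
Qed.

Lemma finite_upper_bound (R : realFieldType) (T : finType) (f : T -> R) :
  exists2 C, 1 <= C & forall t, f t <= C.
Proof.
exists (1 + \sum_t `|f t|); first by rewrite lerDl sumr_ge0.
move=> t; rewrite (bigD1 t)//= addrCA (le_trans (ler_norm _))// lerDl.
by rewrite addr_ge0// sumr_ge0.
Qed.

Lemma finite_lower_bound (R : realFieldType) (T : finType) (f : T -> R) :
  exists d : R, [/\ 0 < d, d <= 1 & forall t, 0 < f t -> d <= f t].
Proof.
have [C C1 fC] := finite_upper_bound (fun t => (f t)^-1).
have C0 : 0 < C by rewrite (lt_le_trans _ C1).
exists C^-1; split=> [||t ft]; rewrite ?invr_gt0 ?invf_le1//.
by rewrite -[leRHS]invrK lef_pV2 ?posrE ?invr_gt0.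
Qed.

(** * Balanced convex combinations *)

Definition simplex_weights (R : numDomainType) (I : finType) (S : {set I})
    (m : I -> R) :=
  [/\ forall j, 0 <= m j, forall j, j \notin S -> m j = 0 & \sum_j m j = 1].

Lemma simplex_weights_mem (R : numDomainType) (I : finType) (S : {set I})
    (m : I -> R) j : simplex_weights S m -> 0 < m j -> j \in S.
Proof.
by move=> [_ mS _] mj; apply: contraTT mj => /mS ->; rewrite ltxx.
Qed.

Lemma set1_neq0 (I : finType) (i : I) : [set i]%SET != finset.set0.
Proof. by apply/finset.set0Pn; exists i; rewrite finset.set11. Qed.

Lemma weighted_sum_ge (R : realFieldType) (I : finType) (l x : I -> R) (b : R) :
  (forall i, 0 <= l i) -> \sum_i l i = 1 -> (forall i, 0 < l i -> b <= x i) ->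
  b <= \sum_i l i * x i.
Proof.
move=> l0 l1 bx; rewrite -[b]mul1r -l1 mulr_suml; apply: ler_sum => i _.
have [->|li] := eqVneq (l i) 0; first by rewrite !mul0r.
by rewrite ler_wpM2l// bx// lt_neqAle eq_sym li/=.
Qed.

Section Bilinear.
Context (R : realType) (E : vectType R) (I : finType) (a : {biscalar E})
  (v : I -> E).
Hypothesis a_pos : forall x, x != 0 -> 0 < a x x.

(** The weights of a point [p] of the convex hull of [v] on [S] with
    [a (v i) p > 0] on [S]. Positivity of all the weights matters as much as
    the sign condition: it lets the value of [- a z p] detect each member of
    [S] that is far from optimal at [z]. *)
Definition balanced_point (S : {set I}) (l : I -> R) :=
  simplex_weights S l /\ (\sum_i l i *: v i = 0 \/
  forall i, i \in S -> 0 < l i /\ 0 < a (v i) (\sum_j l j *: v j)).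

Lemma form_sumr (J : finType) x (c : J -> R) (w : J -> E) :
  a x (\sum_j c j *: w j) = \sum_j c j * a x (w j).
Proof. by rewrite linear_sumr; apply: eq_bigr => j _; rewrite linearZr_LR. Qed.

Lemma form_suml (J : finType) x (c : J -> R) (w : J -> E) :
  a (\sum_j c j *: w j) x = \sum_j c j * a (w j) x.
Proof. by rewrite linear_sumlz; apply: eq_bigr => j _; rewrite linearZl_LR. Qed.

(** The matrix [a (v i) (v j)] on [S] has, by Gordan's alternative, either a
    positive vector with positive image, or a nonzero [q >= 0] with
    [\sum_i q i * a (v i) (v j) <= 0] for all [j]. In the second case
    [a Q Q <= 0] for [Q := \sum_i q i *: v i], so [Q = 0] by positivity. *)
Lemma balanced_point_exists (S : {set I}) :
  S != finset.set0 -> exists l, balanced_point S l.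
Proof.
move=> S0.
pose cut (l : I -> R) i := if i \in S then l i else 0.
(* The left functionals carry the sign conditions, the right ones make every
   weight positive. Outside S the left functional is a harmless coordinate. *)
pose f (k : I + I) (x : {ffun I -> R^o}) : R := match k with
  | inl i => if i \in S then a (v i) (\sum_j cut x j *: v j) else x i
  | inr i => x i end.
have cut_norm l : (forall i, 0 <= l i) -> 0 < \sum_i cut l i ->
    let s := \sum_i cut l i in
    [/\ forall i, 0 <= cut l i / s, forall i, i \notin S -> cut l i / s = 0,
        \sum_i cut l i / s = 1 &
        \sum_i (cut l i / s) *: v i = s^-1 *: \sum_i cut l i *: v i].
  move=> l0 s0 s; have cl0 i : 0 <= cut l i by rewrite /cut; case: ifP.
  split=> [i|i iS||].
  - by rewrite divr_ge0// ltW.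
  - by rewrite /cut (negbTE iS) mul0r.
  - by rewrite -mulr_suml divff// gt_eqF.
  - by rewrite scaler_sumr; apply: eq_bigr => i _; rewrite scalerA mulrC.
have [] := @gordan R {ffun I -> R^o} (I + I)%type f.
- case=> i c x y /=; last by rewrite !ffunE.
  case: ifP => iS; last by rewrite !ffunE.
  rewrite !form_sumr mulr_sumr -big_split/=; apply: eq_bigr => j _.
  by rewrite /cut; case: ifP => _; rewrite ?ffunE /GRing.scale/=; ring.
- move=> [x xf].
  have x0 i : 0 < x i := xf (inr i).
  have [i0 i0S] := set0Pn _ S0.
  have s0 : 0 < \sum_i cut x i.
    rewrite (bigD1 i0)//= /cut i0S ltr_pwDl// sumr_ge0// => i _.
    by case: ifP => // _; apply: ltW.
  have [l0 lS l1 lv] := cut_norm x (fun i => ltW (x0 i)) s0.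
  exists (fun i => cut x i / \sum_i cut x i); split=> //; right=> i iS.
  rewrite lv; split; first by rewrite /cut iS divr_gt0.
  by rewrite linearZr_LR mulr_gt0 ?invr_gt0//; have := xf (inl i); rewrite /= iS.
move=> [q [q0 [k qk] qf]].
pose l i := q (inl i).
have cl0 i : 0 <= cut l i by rewrite /cut; case: ifP => // _; apply: q0.
have lv : \sum_i cut l i *: v i = 0.
  apply/eqP/negPn/negP => /a_pos; rewrite ltNge => /negP; apply.
  have := qf (finfun (cut l)); rewrite big_sumType/=.
  set Q := \sum_i cut l i *: v i.
  have -> : \sum_j cut [ffun i => cut l i] j *: v j = Q.
    by apply: eq_bigr => j _; rewrite /cut; case: ifP; rewrite ?ffunE// => ->.
  have -> : \sum_i q (inl i) * (if i \in S then a (v i) Q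
      else [ffun j => cut l j] i) = a Q Q.
    rewrite form_suml; apply: eq_bigr => i _; rewrite ffunE /cut.
    by case: ifPn => [//|/negbTE ->]; rewrite mulr0 mul0r.
  move=> /eqP; rewrite addr_eq0 => /eqP ->; rewrite oppr_le0 sumr_ge0// => i _.
  by rewrite ffunE mulr_ge0.
have s0 : 0 < \sum_i cut l i.
  rewrite lt_neqAle sumr_ge0// andbT eq_sym psumr_neq0//=.
  apply/negP => /negP/hasPn cl.
  have {}cl i : i \in S -> q (inl i) = 0.
    move=> iS; have := cl i (mem_index_enum _); rewrite /cut iS lt_neqAle q0 andbT.
    by rewrite negbK => /eqP.
  have /eqP := qf [ffun=> 1]; rewrite psumr_eq0 => [/allP/(_ k)|i _].
    move=> /(_ (mem_index_enum _)); rewrite mulf_eq0 (gt_eqF qk)/=.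
    case: k qk => i /=; last by rewrite ffunE oner_eq0.
    case: ifPn => [/cl ->|_]; first by rewrite ltxx.
    by rewrite ffunE oner_eq0.
  case: i => i /=; last by rewrite ffunE mulr1.
  case: ifPn => [/cl ->|_]; first by rewrite mul0r.
  by rewrite ffunE mulr1.
have [l0 lS l1 lV] := cut_norm l (fun i => q0 _) s0.
exists (fun i => cut l i / \sum_i cut l i); split=> //; left.
by rewrite lV lv scaler0.
Qed.
End Bilinear.

(** * A Lyapunov function for greedy paths *)

Section Potential.
Context (R : realFieldType) (I : finType).
Implicit Types (l : {set I} -> I -> R) (x : I -> R) (S : {set I}).

(** In applications [x j] is [- a z (v j)], which is largest at the greedy
    choice, and the first sum is [- a z p] for [p] with weights [l S]. *)
Definition potential l (c q D : R) x S :=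
  \sum_j l S j * x j + c * q ^+ #|S| * D.

(** Here [i] is a nearly maximal entry of [x]. If all entries of [S] are within
    [K * D] of [x i], then enlarging [S] by [i] lowers the average by a
    controlled amount, less than the gain in the geometric term. Otherwise some
    entry of [S] is far below, and as its weight is at least [d] the average is
    so low that the singleton [[set i]] has the larger potential. *)
Lemma potential_dominated l d c D x i S :
  0 < d -> 0 <= c -> 0 <= D ->
  (forall T, T != finset.set0 -> simplex_weights T (l T)) ->
  S != finset.set0 -> (forall j, j \in S -> d <= l S j) -> i \notin S ->
  (forall j, j \in S -> x j <= x i + c * D) ->
  let F := potential l c (2 + 2 / d) D x in
  F S <= F (i |: S)%SET \/ F S <= F [set i]%SET.
Proof.
move=> d0 c0 D0 lw S0 lS iS xS F; set q := 2 + 2 / d.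
have [l0 lout l1] := lw S S0.
have d20 : 0 < 2 / d by rewrite divr_gt0.
have q1 : 1 <= q by rewrite /q; lra.
have qS1 : 1 <= q ^+ #|S| by rewrite exprn_ege1.
have up : \sum_j l S j * x j <= x i + c * D.
  rewrite -lerN2 -sumrN.
  under eq_bigr do rewrite -mulrN.
  apply: weighted_sum_ge => // j lj; rewrite lerN2 xS//.
  exact: simplex_weights_mem (lw S S0) lj.
(* K is the threshold at which the loss d * K * D makes up for the geometric term
   of S together with the tolerance c * D *)
pose K := (c + c * q ^+ #|S|) / d.
have [xK|] := pselect (forall j, j \in S -> x i - K * D <= x j).
- left; rewrite /F /potential cardsU1 iS exprS.
  have SU0 : (i |: S)%SET != finset.set0.
    by apply/finset.set0Pn; exists i; rewrite finset.setU11.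
  have [l0' _ l1'] := lw _ SU0.
  have lo : x i - K * D <= \sum_j l (i |: S)%SET j * x j.
    apply: weighted_sum_ge => // j lj.
    have := simplex_weights_mem (lw _ SU0) lj.
    rewrite in_setU1 => /predU1P[->|/xK//].
    rewrite gerBl mulr_ge0// /K divr_ge0 ?(ltW d0)// addr_ge0// mulr_ge0//.
    by rewrite (le_trans _ qS1).
  have e1 : 0 <= c * (q ^+ #|S| - 1) * D by rewrite !mulr_ge0// subr_ge0.
  have e2 : 0 <= c * (q ^+ #|S| - 1) * D / d by rewrite divr_ge0 ?(ltW d0).
  rewrite -/q; move: up lo e1 e2; rewrite /K /q.
  move: (q ^+ #|S|) (\sum_j l S j * x j) (\sum_j _) => Q s s'.
  move: d^-1 => e; lra.
- move=> /existsNP[j /not_implyP[jS /negP]]; rewrite -ltNge => xj.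
  right; rewrite /F /potential.
  have [m0 mout m1] := lw _ (set1_neq0 i).
  have -> : \sum_k l [set i]%SET k * x k = x i.
    rewrite (bigD1 i)//= big1 ?addr0 => [|k ki]; last first.
      by rewrite mout ?mul0r// finset.in_set1.
    suff -> : l [set i]%SET i = 1 by rewrite mul1r.
    rewrite -m1 (bigD1 i)//= big1 ?addr0// => k ki.
    by rewrite mout// finset.in_set1.
  have lj0 : d <= l S j := lS j jS.
  have up' : \sum_k l S k * x k <= l S j * (x i - K * D) + (1 - l S j) * (x i + c * D).
    have -> : 1 - l S j = \sum_(k | k != j) l S k.
      by rewrite -l1 (bigD1 j)//= addrAC subrr add0r.
    rewrite (bigD1 j)//= lerD//; first by rewrite ler_wpM2l// ltW.
    rewrite mulr_suml ler_sum// => k kj.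
    have [->|lk] := eqVneq (l S k) 0; first by rewrite !mul0r.
    rewrite ler_wpM2l// xS//; apply: (simplex_weights_mem (lw S S0)).
    by rewrite lt_neqAle eq_sym lk/=.
  have K0 : 0 <= K * D + c * D.
    rewrite -mulrDl mulr_ge0// addr_ge0// /K divr_ge0 ?(ltW d0)// addr_ge0// mulr_ge0//.
    by rewrite (le_trans _ qS1).
  have lK : d * (K * D + c * D) <= l S j * (K * D + c * D) by rewrite ler_wpM2r.
  have dK : d * K = c + c * q ^+ #|S| by rewrite /K mulrC divfK ?gt_eqF.
  have dKD : d * (K * D) = c * D + c * q ^+ #|S| * D by rewrite mulrA dK; ring.
  have dc : 0 <= d * (c * D) by rewrite !mulr_ge0 ?(ltW d0).
  have cq : 0 <= c * q ^+ #|[set i]%SET| * D.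
    by rewrite !mulr_ge0// exprn_ge0// (le_trans _ q1).
  move: up' lK dKD dc cq; rewrite -/q.
  move: (q ^+ _) (q ^+ _) (\sum_j _) (l S j) => Q Q' s lj; lra.
Qed.
End Potential.

Section Lyapunov.
Context (R : realType) (E : vectType R) (I : finType) (a : {biscalar E})
  (v : I -> E).
Hypothesis a_pos : forall x, x != 0 -> 0 < a x x.
Variable (J : {set I}).

(** Steps of weight zero are unconstrained, so that a projected path in which
    some moves vanish is still a greedy path. *)
Definition greedy_path (D : R) (z : nat -> E) (w : nat -> R) (i : nat -> I) :=
  forall k, [/\ z k.+1 = z k + w k *: v (i k), 0 <= w k <= D &
    w k != 0 -> i k \in J /\
      forall j, j \in J -> a (z k) (v (i k)) <= a (z k) (v j) + D].

Lemma form_step z w i x : a (z + w *: v i) x = a z x + w * a (v i) x.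
Proof. by rewrite linearDl linearZl_LR. Qed.

Section Step.
Variables (l : {set I} -> I -> R) (d eta G D : R).
Local Notation P S := (\sum_j l S j *: v j).
Local Notation F z :=
  (potential l (1 + 2 * G) (2 + 2 / d) D (fun j => - a z (v j))).
Hypotheses (d0 : 0 < d) (D0 : 0 <= D) (G0 : 0 <= G)
  (aG : forall i j, `|a (v i) (v j)| <= G)
  (lw : forall S : {set I}, S != finset.set0 -> simplex_weights S (l S))
  (l_alt : forall S : {set I}, S != finset.set0 -> S \subset J ->
     (forall i, i \in S -> eta <= a (v i) (P S)) /\
     ((forall i, i \in S -> d <= l S i) \/ (P S = 0 /\ eta = 0))).

(** For [S] containing [i] the potential drops by [w * a (v i) p_S]. For the
    other sets it is compared, after the step, with a set containing [i]. The
    tolerance [1 + 2 * G] is the one between the optimality of [i] before the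
    step, up to [D], and after it. *)
Lemma potential_step (H : R) z w i : 0 <= w <= D -> i \in J ->
  (forall j, j \in J -> a z (v i) <= a z (v j) + D) ->
  (forall S : {set I}, S != finset.set0 -> S \subset J -> F z S <= H) ->
  forall S : {set I}, S != finset.set0 -> S \subset J ->
    F (z + w *: v i) S <= H - w * eta.
Proof.
move=> /andP[w0 wD] iJ greedy FH S S0 SJ; set z' := z + w *: v i.
have FE T : F z' T = F z T - w * a (v i) (P T).
  rewrite /potential form_sumr mulr_sumr [RHS]addrAC -sumrB; congr (_ + _).
  by apply: eq_bigr => j _; rewrite /z' form_step; ring.
have Fi (T : {set I}) : i \in T -> T \subset J -> F z' T <= H - w * eta.
  move=> iT TJ; have T0 : T != finset.set0 by apply/finset.set0Pn; exists i.
  by rewrite FE lerB ?FH// ler_wpM2l//; have [+ _] := l_alt T0 TJ; apply.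
have [iS|iS] := boolP (i \in S); first exact: Fi.
have [_ [ld|[P0 eta0]]] := l_alt S0 SJ; last first.
  by rewrite FE P0 linear0r eta0 !mulr0 !subr0 FH.
have gap j : j \in S -> - a z' (v j) <= - a z' (v i) + (1 + 2 * G) * D.
  move=> jS; rewrite /z' !form_step.
  have := greedy j (fintype.subsetP SJ j jS).
  have ai : w * a (v i) (v i) <= D * G.
    rewrite (le_trans (ler_wpM2l w0 (ler_norm _)))// ler_pM//.
  have aj : - (w * a (v i) (v j)) <= D * G.
    rewrite -mulrN (le_trans (ler_wpM2l w0 (ler_norm _)))// normrN ler_pM//.
  lra.
have c0 : 0 <= 1 + 2 * G by rewrite addr_ge0// mulr_ge0.
case: (potential_dominated d0 c0 D0 lw S0 ld iS gap) => /le_trans; apply; apply: Fi.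
- by rewrite finset.setU11.
- by rewrite finset.subUset finset.sub1set iJ.
- by rewrite finset.set11.
- by rewrite finset.sub1set.
Qed.

Lemma potential_path (H : R) z w i : greedy_path D z w i ->
  (forall S : {set I}, S != finset.set0 -> S \subset J -> F (z 0%N) S <= H) ->
  forall k S, S != finset.set0 -> S \subset J ->
    F (z k) S <= H - eta * \sum_(0 <= n < k) w n.
Proof.
move=> zP FH; elim=> [|k IHk] S S0 SJ; first by rewrite big_geq// mulr0 subr0 FH.
have [-> wD sel] := zP k; rewrite big_nat_recr//= mulrDr opprD addrA.
have [w0|/sel[iJ greedy]] := eqVneq (w k) 0.
  by rewrite w0 mulr0 subr0 scale0r addr0 IHk.
by rewrite [eta * w k]mulrC; apply: potential_step.
Qed.

Lemma potential_init z (S : {set I}) :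
  S != finset.set0 -> (forall j, `|a z (v j)| <= D) ->
  F z S <= D + (1 + 2 * G) * (2 + 2 / d) ^+ #|I| * D.
Proof.
move=> S0 aD; have [l0 _ l1] := lw S0.
have d20 : 0 < 2 / d by rewrite divr_gt0.
rewrite lerD//.
  rewrite -[leRHS]mul1r -l1 mulr_suml ler_sum// => j _.
  by rewrite ler_wpM2l// (le_trans (ler_norm _))// normrN.
rewrite ler_wpM2r// ler_wpM2l//; first by rewrite addr_ge0// mulr_ge0.
by rewrite ler_weXn2l ?max_card//; lra.
Qed.

Lemma potential_ge z i : - a z (v i) <= F z [set i]%SET.
Proof.
have [l0 lout l1] := lw (set1_neq0 i).
have d20 : 0 < 2 / d by rewrite divr_gt0.
apply: (@le_trans _ _ (\sum_j l [set i]%SET j * - a z (v j))); last first.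
  have q0 : 0 <= 2 + 2 / d by rewrite addr_ge0// ltW.
  by rewrite lerDl mulr_ge0// mulr_ge0 ?exprn_ge0// addr_ge0// mulr_ge0.
apply: weighted_sum_ge => // j /(simplex_weights_mem (lw (set1_neq0 i))).
by rewrite finset.in_set1 => /eqP ->.
Qed.

End Step.

(** Finiteness turns the pointwise positivity of [balanced_point] into uniform
    constants. *)
Lemma lyapunov_data : exists (l : {set I} -> I -> R) (d e G : R),
  [/\ 0 < d, 0 < e & 0 <= G] /\
  [/\ forall i j, `|a (v i) (v j)| <= G,
    forall S : {set I}, S != finset.set0 -> simplex_weights S (l S) &
    forall S : {set I}, S != finset.set0 -> \sum_j l S j *: v j = 0 \/
    forall i, i \in S -> d <= l S i /\ e <= a (v i) (\sum_j l S j *: v j)].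
Proof.
have /choice[l lP] : forall S : {set I}, exists m, S != finset.set0 ->
    balanced_point a v S m.
  move=> S; have [->|S0] := eqVneq S finset.set0; first by exists (fun=> 0).
  by have [m] := balanced_point_exists v a_pos S0; exists m.
pose P S := \sum_j l S j *: v j.
have [d [d0 _ ld]] := finite_lower_bound (fun t : {set I} * I => l t.1 t.2).
have [e [e0 _ ae]] :=
  finite_lower_bound (fun t : {set I} * I => a (v t.2) (P t.1)).
have [G G1 aG] := finite_upper_bound (fun t : I * I => `|a (v t.1) (v t.2)|).
exists l, d, e, G; split; first by split=> //; lra.
split=> [i j|S S0|S S0]; first exact: (aG (i, j)).
  by have [] := lP S S0.
have [_ [|lS]] := lP S S0; first by left.
by right=> i /lS[li ai]; split; [exact: (ld (S, i))|exact: (ae (S, i))].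
Qed.

(** [- a (z k) (v j)] is dominated by the potential of [[set j]], which keeps
    its initial bound; no decrease of the potentials is needed here, so the
    sets [S] with [p_S = 0] are allowed. *)
Lemma greedy_lower_bound : exists2 C : R, 0 <= C &
  forall (D : R) z w i, 0 <= D -> greedy_path D z w i ->
    (forall j, `|a (z 0%N) (v j)| <= D) ->
    forall k j, j \in J -> - (C * D) <= a (z k) (v j).
Proof.
have [l [d [e [G [[d0 e0 G0] [aG lw lalt]]]]]] := lyapunov_data.
have d20 : 0 < 2 / d by rewrite divr_gt0.
exists (1 + (1 + 2 * G) * (2 + 2 / d) ^+ #|I|).
  by rewrite addr_ge0// mulr_ge0 ?exprn_ge0//; lra.
move=> D z w i D0 zP z0 k j jJ.
have SJ : [set j]%SET \subset J by rewrite finset.sub1set.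
rewrite lerNl (le_trans (potential_ge d0 D0 G0 lw _ _))//.
rewrite -[leRHS]subr0 -[X in _ - X](mul0r (\sum_(0 <= n < k) w n)).
apply: (potential_path d0 D0 G0 aG lw _ zP _ k (set1_neq0 j) SJ) => [S S1 _|S S1 _].
  have [P0|Pp] := lalt S S1.
    by split; [move=> n nS; rewrite P0 linear0r|right].
  split; first by move=> n /Pp[_ /(le_trans (ltW e0))].
  by left=> n /Pp[].
rewrite [leRHS]mulrDl mul1r.
exact: (potential_init d0 D0 G0 lw).
Qed.

(** Without nonnegative relations no [p_S] vanishes, so the bound on the
    potentials drops by [e * w k] at each step. It cannot drop forever: whenever
    a vector is chosen, the potential of its singleton is at least [- D]. *)
Lemma greedy_total_weight :
  (forall m : I -> R, (forall i, 0 <= m i) ->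
     (forall i, i \notin J -> m i = 0) ->
     \sum_i m i *: v i = 0 -> forall i, m i = 0) ->
  exists2 C : R, 0 <= C &
  forall (D : R) z w i, 0 <= D -> greedy_path D z w i ->
    (forall j, `|a (z 0%N) (v j)| <= D) ->
    (forall k, w k != 0 -> a (z k) (v (i k)) <= D) ->
    forall T, \sum_(0 <= k < T) w k <= C * D.
Proof.
move=> indep.
have [l [d [e [G [[d0 e0 G0] [aG lw lalt]]]]]] := lyapunov_data.
have d20 : 0 < 2 / d by rewrite divr_gt0.
set K := (1 + 2 * G) * (2 + 2 / d) ^+ #|I|.
have K0 : 0 <= K by rewrite mulr_ge0 ?exprn_ge0//; lra.
exists ((2 + K) / e + 1); first by rewrite addr_ge0// divr_ge0 ?(ltW e0)//; lra.
move=> D z w i D0 zP z0 sel.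
have CD0 : 0 <= ((2 + K) / e) * D by rewrite mulr_ge0// divr_ge0 ?(ltW e0)//; lra.
(* only at times of nonzero weight is the chosen vector known to be nearly
   minimizing; the other times reduce to the preceding one *)
elim=> [|T IHT]; first by rewrite big_geq// mulrDl; lra.
rewrite big_nat_recr//=; have [->|wT] := eqVneq (w T) 0; first by rewrite addr0.
have [_ /andP[_ wD] /(_ wT)[iJ _]] := zP T.
have SJ : [set i T]%SET \subset J by rewrite finset.sub1set.
rewrite mulrDl mul1r lerD// mulrAC ler_pdivlMr// mulrC.
have lo : - D <= potential l (1 + 2 * G) (2 + 2 / d) D
    (fun j => - a (z T) (v j)) [set i T]%SET.
  by rewrite (le_trans _ (potential_ge d0 D0 G0 lw _ _))// lerN2 sel.
have := le_trans lo (potential_path d0 D0 G0 aG lw (eta := e) _ zP _ T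
  (set1_neq0 (i T)) SJ).
move=> /(_ (D + K * D)) H.
suff : - D <= D + K * D - e * \sum_(0 <= n < T) w n by lra.
apply: H => [S S1 SJ1|S S1 _]; last exact: (potential_init d0 D0 G0 lw).
have [l0 lout l1] := lw S S1.
have [P0|Pp] := lalt S S1.
  exfalso; have l00 : forall n, l S n = 0.
    apply: indep => // n nJ; apply: lout.
    by apply: contra nJ; exact: (fintype.subsetP SJ1).
  move: l1; rewrite big1// => /esym /eqP; rewrite oner_eq0//.
split; first by move=> n /Pp[].
by left=> n /Pp[].
Qed.

End Lyapunov.

(** * Projections and representation for a positive bilinear form *)

Section ObliqueProjection.
Context (R : realType) (E : vectType R) (a : {biscalar E}).
Hypothesis a_pos : forall x, x != 0 -> 0 < a x x.

Lemma form_span_eq0 (X : seq E) x :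
  (forall y, y \in X -> a x y = 0) -> forall y, y \in <<X>>%VS -> a x y = 0.
Proof.
move=> xX y /(@coord_span _ _ _ (in_tuple X)) ->; rewrite linear_sumr big1// => i _.
by rewrite linearZr_LR/= xX ?mulr0// mem_nth.
Qed.

(** Gram-Schmidt without symmetry: adjoining [v], the new projection subtracts
    the multiple of [p v] that restores orthogonality to [v]; the pivot
    [a (p v) v] equals [a (p v) (p v)], hence is nonzero unless [v] already
    lies in the span. *)
Lemma oblique_projection (X : seq E) : exists p : {linear E -> E},
  forall x, x - p x \in <<X>>%VS /\ forall y, y \in X -> a (p x) y = 0.
Proof.
elim: X => [|v X [p pP]].
  by exists idfun => x; split=> //=; rewrite subrr mem0v.
have sub x : x \in <<X>>%VS -> x \in <<v :: X>>%VS.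
  by apply/subvP; rewrite span_cons addvSr.
have [pv0|pv0] := eqVneq (p v) 0.
  exists p => x; have [xp pX] := pP x; split=> [|y]; first exact: sub.
  rewrite inE => /predU1P[->|/pX//].
  have [vp _] := pP v; rewrite pv0 subr0 in vp.
  exact: form_span_eq0 pX v vp.
have pvv : a (p v) v = a (p v) (p v).
  have [vp pXv] := pP v.
  by apply/eqP; rewrite -subr_eq0 -linearBr/= (form_span_eq0 pXv vp).
have a0 : a (p v) v != 0 by rewrite pvv gt_eqF// a_pos.
pose f x := p x - (a (p x) v / a (p v) v) *: p v.
have f_lin : linear f.
  move=> c x y; rewrite /f linearP linearDl linearZl_LR/= scalerBr scalerA.
  by rewrite mulrDl -mulrA [X in _ - X]scalerDl opprD addrACA.
pose F : {linear E -> E} := HB.pack f (GRing.isLinear.Build _ _ _ _ f f_lin).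
exists F => x; have [xp pX] := pP x; have [vp pXv] := pP v; split => /=.
  have vX : v \in <<v :: X>>%VS by rewrite memv_span// mem_head.
  have pvX : p v \in <<v :: X>>%VS.
    by rewrite -[p v](subKr v) rpredB// sub.
  by rewrite /f opprB addrCA; apply: rpredD; [exact: rpredZ|exact: sub].
move=> y; rewrite inE /f linearBl linearZl_LR/=.
move=> /predU1P[->|yX]; first by rewrite divfK ?subrr.
by rewrite (pX _ yX) (pXv _ yX) mulr0 subrr.
Qed.

(** The representing vector is a multiple of the projection [n], orthogonal to
    the kernel of [f], of any vector where [f] does not vanish. *)
Lemma riesz_representation (f : E -> R) : scalar f ->
  exists r, forall x, f x = a r x.
Proof.
move=> f_lin.
have [[x fx]|f0] := pselect (exists x, f x != 0); last first.
  exists 0 => x; rewrite linear0l; apply/eqP/negPn/negP => fx.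
  by apply: f0; exists x.
have f00 : f 0 = 0 by have := f_lin (-1) 0 0; rewrite scaler0 addr0; lra.
pose g : {linear E -> R^o} := HB.pack (f : E -> R^o)
  (GRing.isLinear.Build _ _ _ _ (f : E -> R^o) f_lin).
pose L := linfun g.
have kerP y : (y \in lker L) = (f y == 0) by rewrite memv_ker lfunE.
have [p pP] := oblique_projection (vbasis (lker L)).
have [xp pX] := pP x; set n := p x in xp pX.
have fn : f n != 0.
  move: xp; rewrite (span_basis (vbasisP _)) kerP -scaleN1r addrC f_lin mulN1r.
  by rewrite addrC subr_eq0 => /eqP <-.
have n0 : n != 0 by apply: contraNneq fn => ->; rewrite f00.
have an := a_pos n0.
exists ((f n / a n n) *: n) => y.
have : y - (f y / f n) *: n \in <<vbasis (lker L)>>%VS.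
  by rewrite (span_basis (vbasisP _)) kerP addrC -scaleNr f_lin mulNr divfK// addrC subrr.
move=> /(form_span_eq0 pX)/eqP; rewrite linearBr linearZr_LR/= subr_eq0 => /eqP ay.
by rewrite linearZl_LR/= ay; field; rewrite fn gt_eqF.
Qed.
End ObliqueProjection.

(** * The norm of the inner product *)

Section Norm.
Context (R : realType) (E : vectType R) (dot : {dot E for idfun}).

Lemma dotC x y : dot x y = dot y x.
Proof. by rewrite hermC expr0 mul1r. Qed.

Lemma dot_ge0 x : 0 <= dot x x.
Proof.
by have [->|x0] := eqVneq x 0; rewrite ?linear0r// ltW// neq0_dnorm_gt0.
Qed.

Lemma dnorm_ge0 x : 0 <= dnorm dot x. Proof. exact: sqrtr_ge0. Qed.

Lemma dnorm_sqr x : dnorm dot x ^+ 2 = dot x x.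
Proof. by rewrite sqr_sqrtr// dot_ge0. Qed.

Lemma dnorm_gt0 x : x != 0 -> 0 < dnorm dot x.
Proof. by move=> x0; rewrite sqrtr_gt0 neq0_dnorm_gt0. Qed.

Lemma dnormZ c x : dnorm dot (c *: x) = `|c| * dnorm dot x.
Proof.
rewrite /dnorm linearZl_LR linearZr_LR/= mulrA -expr2 sqrtrM ?sqr_ge0//.
by rewrite sqrtr_sqr.
Qed.

Lemma dot_cauchy_schwarz x y : `|dot x y| <= dnorm dot x * dnorm dot y.
Proof.
have [->|y0] := eqVneq y 0; first by rewrite linear0r normr0 mulr_ge0// dnorm_ge0.
have yy : 0 < dot y y by rewrite neq0_dnorm_gt0.
have [c cy] : exists c, c * dot y y = dot x y.
  by exists (dot x y / dot y y); rewrite divfK// gt_eqF.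
have := dot_ge0 (x - c *: y).
rewrite linearBl !linearBr !linearZl_LR !linearZr_LR/= (dotC y x) cy subrr subr0.
move=> /(mulr_ge0 (ltW yy)) xy.
rewrite -(ler_pXn2r (n := 2)) ?nnegrE ?mulr_ge0 ?dnorm_ge0//.
rewrite exprMn !dnorm_sqr real_normK ?num_real//; nra.
Qed.

Lemma dnormD x y : dnorm dot (x + y) <= dnorm dot x + dnorm dot y.
Proof.
rewrite -(ler_pXn2r (n := 2)) ?nnegrE ?addr_ge0 ?dnorm_ge0//.
rewrite sqrrD !dnorm_sqr linearDl !linearDr/= (dotC y x).
have := le_trans (ler_norm _) (dot_cauchy_schwarz x y).
lra.
Qed.

Lemma dnorm_sum (I : Type) (r : seq I) (F : I -> E) :
  dnorm dot (\sum_(i <- r) F i) <= \sum_(i <- r) dnorm dot (F i).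
Proof.
elim/big_ind2: _ => [|x1 x2 y1 y2 h1 h2|//].
  by rewrite /dnorm linear0r sqrtr0.
by rewrite (le_trans (dnormD _ _))// lerD.
Qed.

Lemma energy_bilinear (A : {linear E -> E}) :
  bilinear_for *%R *%R (fun x y => dot (A x) y).
Proof.
split=> y c x1 x2; first by rewrite linearP linearDl linearZl_LR.
by rewrite linearDr linearZr_LR.
Qed.

Definition energy (A : {linear E -> E}) : {biscalar E} :=
  HB.pack (fun x y => dot (A x) y)
    (bilinear_isBilinear.Build _ _ _ _ _ _ _ (energy_bilinear A)).

Lemma bounded_functional (f : E -> R) : scalar f ->
  exists2 C : R, 0 <= C & forall x, `|f x| <= C * dnorm dot x.
Proof.
move=> f_lin.
have pos x : x != 0 -> 0 < energy idfun x x by move=> x0; rewrite neq0_dnorm_gt0.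
have [r fr] := riesz_representation pos f_lin.
exists (dnorm dot r); first exact: dnorm_ge0.
by move=> x; rewrite fr; exact: dot_cauchy_schwarz.
Qed.

End Norm.

(** * The recurrent subspace *)

Lemma bounded_functionals (R : realType) (E : vectType R)
    (dot : {dot E for idfun}) (I : finType) (f : I -> E -> R) :
  (forall i, scalar (f i)) ->
  exists2 N : R, 1 <= N & forall i x, `|f i x| <= N * dnorm dot x.
Proof.
move=> f_lin.
have /choice[C CP] : forall i, exists C : R, forall x, `|f i x| <= C * dnorm dot x.
  by move=> i; have [C _ CP] := bounded_functional dot (f_lin i); exists C.
have [N N1 CN] := finite_upper_bound C.
exists N => // i x; rewrite (le_trans (CP i x))// ler_wpM2r// dnorm_ge0//.
Qed.

(** Expanding the second argument of [a x x] in [X], with coordinates bounded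
    by a multiple of the norm of [x], gives
    [mu * dnorm dot x ^+ 2 <= C * dnorm dot x * D]. *)
Lemma span_norm_bound (R : realType) (E : vectType R)
    (dot : {dot E for idfun}) (a : {biscalar E}) (mu : R) (X : seq E) :
  0 < mu -> (forall x, mu * dnorm dot x ^+ 2 <= a x x) ->
  exists2 C : R, 0 <= C & forall (D : R) x, 0 <= D -> x \in <<X>>%VS ->
    (forall y, y \in X -> `|a x y| <= D) -> dnorm dot x <= C * D.
Proof.
move=> mu0 coer.
have [|N N1 coordN] := @bounded_functionals _ _ dot 'I_(size X)
    (fun i => coord (in_tuple X) i).
  by move=> i c x y; rewrite linearP.
have N0 : 0 <= N by lra.
exists ((size X)%:R * N / mu); first by rewrite divr_ge0 ?(ltW mu0)// mulr_ge0.
move=> D x D0 xX aD.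
have [->|x0] := eqVneq x 0.
  by rewrite -(scale0r 0) dnormZ normr0 mul0r !mulr_ge0// invr_ge0 ltW.
have x_gt0 := dnorm_gt0 dot x0.
have : a x x <= (size X)%:R * (N * dnorm dot x * D).
  rewrite [X in a x X](@coord_span _ _ _ (in_tuple X) _ xX) linear_sumr.
  rewrite -[X in X%:R * _]card_ord -sum1_card natr_sum mulr_suml.
  apply: ler_sum => i _; rewrite mul1r linearZr_LR/= (le_trans (ler_norm _))//.
  by rewrite normrM ler_pM// aD// mem_nth.
move=> /(le_trans (coer x)); rewrite expr2 => h.
rewrite -(ler_pM2l mu0) -(ler_pM2r x_gt0).
have -> : mu * ((size X)%:R * N / mu * D) * dnorm dot x =
          (size X)%:R * (N * dnorm dot x * D).
  by field; rewrite gt_eqF.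
by rewrite -mulrA.
Qed.

Lemma span_family (R : fieldType) (E : vectType R) (I : finType) (v : I -> E)
    (F : {set I}) x : x \in <<[seq v i | i in F]>>%VS ->
  exists c : I -> R, (forall i, i \notin F -> c i = 0) /\ x = \sum_i c i *: v i.
Proof.
rewrite span_def big_map big_enum/= => /memv_sumP[y yv ->].
have /choice[c cP] : forall i, exists k, i \in F -> y i = k *: v i.
  move=> i; have [/yv/vlineP[k yk]|_] := boolP (i \in F); first by exists k.
  by exists 0.
exists (fun i => if i \in F then c i else 0); split=> [i iF|].
  by rewrite (negbTE iF).
rewrite big_mkcond; apply: eq_bigr => i _.
by case: ifPn => [/cP ->|iF] //; rewrite scale0r.
Qed.

Section StateBound.
Context (R : realType) (E : vectType R) (I : finType) (v : I -> E).

Definition relation (l : I -> R) :=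
  (forall i, 0 <= l i) /\ \sum_i l i *: v i = 0.

(** If [0] lies in the convex hull of the vectors, these are the indices of the
    vectors on its smallest face containing [0]. *)
Definition recurrent : {set I} :=
  [set i | `[< exists2 l, relation l & 0 < l i >]]%SET.

Lemma relation_support l i : relation l -> i \notin recurrent -> l i = 0.
Proof.
move=> lr; apply: contraNeq => li; rewrite inE; apply/asboolP; exists l => //.
by rewrite lt_neqAle eq_sym li lr.1.
Qed.

(** The sum of one relation for each recurrent index. *)
Lemma recurrent_relation :
  exists2 l, relation l & forall i, i \in recurrent -> 0 < l i.
Proof.
have /choice[l lP] : forall i, exists l, relation l /\
    (i \in recurrent -> 0 < l i).
  move=> i; have [|_] := boolP (i \in recurrent).
    by rewrite inE => /asboolP[l lr li]; exists l.
  exists (fun=> 0); split=> //; split=> //.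
  by rewrite big1// => j _; rewrite scale0r.
exists (fun j => \sum_i l i j) => [|j jF].
  split=> [j|]; first by rewrite sumr_ge0// => i _; have [[]] := lP i.
  under eq_bigr do rewrite scaler_suml.
  by rewrite exchange_big big1//= => i _; have [[]] := lP i.
rewrite (bigD1 j)//= ltr_pwDl//; first by have [_ /(_ jF)] := lP j.
by rewrite sumr_ge0// => i _; have [[]] := lP i.
Qed.

(** A nonnegative relation between projected transient vectors says that
    [\sum_i m i *: v i] is in the span of the recurrent ones, with
    coefficients [c] of any sign. Adding a large multiple of a relation that is
    positive on all recurrent indices makes the coefficients nonnegative, so
    every [i] with [m i > 0] would be recurrent. *)
Lemma transient_independent (p : {linear E -> E}) :
  (forall x, x - p x \in <<[seq v i | i in recurrent]>>%VS) ->
  forall m : I -> R, (forall i, 0 <= m i) ->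
    (forall i, i \notin ~: recurrent -> m i = 0) ->
    \sum_i m i *: p (v i) = 0 -> forall i, m i = 0.
Proof.
move=> pP m m0 mF mp i.
have [iF|iF] := boolP (i \in recurrent); first by rewrite mF// finset.in_setC iF.
have : \sum_i m i *: v i \in <<[seq v i | i in recurrent]>>%VS.
  have := pP (\sum_i m i *: v i); rewrite linear_sum/=.
  under [X in _ - X]eq_bigr do rewrite linearZ/=.
  by rewrite mp subr0.
move=> /span_family[c [cF mc]].
have [l [l0 ls] lF] := recurrent_relation.
have [t t1 ct] := finite_upper_bound (fun i => c i / l i).
apply: contraTeq (iF) => mi; rewrite negbK inE; apply/asboolP.
exists (fun j => m j + t * l j - c j); last first.
  rewrite cF// (relation_support (conj l0 ls))// mulr0 addr0 subr0.
  by rewrite lt_neqAle eq_sym mi m0.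
split=> [j|].
  have [jF|jF] := boolP (j \in recurrent); last first.
    by rewrite cF// (relation_support (conj l0 ls))// mulr0 addr0 subr0.
  have -> : m j = 0 by rewrite mF// finset.in_setC jF.
  by rewrite add0r subr_ge0 -ler_pdivrMr ?lF.
under eq_bigr do rewrite scalerBl scalerDl -scalerA.
by rewrite sumrB big_split/= -scaler_sumr ls scaler0 addr0 mc subrr.
Qed.
End StateBound.

(** * Boundedness of greedy paths *)

(** A relation positive at [j] expresses [a (z k) (v j)] as a negative
    combination of the other values, which are bounded below. *)
Lemma greedy_upper_bound (R : realType) (E : vectType R) (I : finType)
    (a : {biscalar E}) (v : I -> E) :
  (forall x, x != 0 -> 0 < a x x) ->
  exists2 C : R, 0 <= C & forall (D : R) z w i, 0 <= D ->
    greedy_path a v [set: I]%SET D z w i ->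
    (forall j, `|a (z 0%N) (v j)| <= D) ->
    forall k j, j \in recurrent v -> `|a (z k) (v j)| <= C * D.
Proof.
move=> a_pos.
have [C C0 CP] := greedy_lower_bound v a_pos [set: I]%SET.
have [l [l0 ls] lF] := recurrent_relation v.
have [d [d0 d1 ld]] := finite_lower_bound l.
have L0 : 0 <= \sum_i l i by rewrite sumr_ge0.
exists ((\sum_i l i) / d * C + C).
  by rewrite addr_ge0// !mulr_ge0// invr_ge0 ltW.
move=> D z w i D0 zP z0 k j jF.
have lo n : - (C * D) <= a (z k) (v n) by apply: (CP D z w i) => //; rewrite finset.in_setT.
have CD0 : 0 <= C * D by rewrite mulr_ge0.
have LCD : 0 <= (\sum_i l i) / d * (C * D) by rewrite !mulr_ge0// invr_ge0 ltW.
rewrite mulrDl -mulrA ler_norml; apply/andP; split.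
  by rewrite (le_trans _ (lo j))// opprD gerDr oppr_le0.
rewrite (@le_trans _ _ ((\sum_i l i) / d * (C * D)))//; last by rewrite lerDl.
rewrite mulrAC ler_pdivlMr//.
have [aj|aj] := leP (a (z k) (v j)) 0.
  by rewrite (@le_trans _ _ 0)// ?mulr_ge0// mulr_le0_ge0// ltW.
apply: (@le_trans _ _ (l j * a (z k) (v j))).
  by rewrite mulrC ler_wpM2r ?(ltW aj)// ld// lF.
have : \sum_n l n * a (z k) (v n) = 0.
  by rewrite -form_sumr ls linear0r.
rewrite (bigD1 j)//= => /eqP; rewrite addr_eq0 => /eqP ->.
rewrite -sumrN mulr_suml [leRHS](bigD1 j)//= -[leLHS]add0r lerD ?mulr_ge0//.
by apply: ler_sum => n _; rewrite -mulrN ler_wpM2l// lerNl.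
Qed.

(** The state splits as [p (z k)], orthogonal to the recurrent vectors for [a],
    plus [z k - p (z k)] in their span. The second part is controlled at every
    time by [greedy_upper_bound]; being small, it perturbs the greedy rule
    only by a multiple of [D], so the first part follows a greedy path for the
    projected transient vectors, whose total weight is bounded. *)
Lemma state_bound (R : realType) (E : vectType R) (I : finType)
    (dot : {dot E for idfun}) (a : {biscalar E}) (mu : R) (v : I -> E)
    (l : I -> R) :
  0 < mu -> (forall x, mu * dnorm dot x ^+ 2 <= a x x) ->
  relation v l -> \sum_i l i = 1 ->
  exists2 C : R, 1 <= C & forall (D : R) z w i, dnorm dot (z 0%N) <= D ->
    greedy_path a v [set: I]%SET D z w i ->
    forall k, dnorm dot (z k) <= C * D.
Proof.
move=> mu0 coer [l0 lv] l1.
have a_pos x : x != 0 -> 0 < a x x.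
  by move=> x0; rewrite (lt_le_trans _ (coer x))// mulr_gt0// exprn_gt0// dnorm_gt0.
have [|N N1 aN] := @bounded_functionals _ _ dot I (fun i x => a x (v i)).
  by move=> i c x y; rewrite linearDl linearZl_LR.
have N0 : 0 <= N by rewrite (le_trans _ N1).
set X := [seq v i | i in recurrent v].
have [p pP] := oblique_projection a_pos X.
have p_orth x y : y \in <<X>>%VS -> a (p x) y = 0.
  by apply: form_span_eq0; exact: (pP x).2.
have pX x : x \in <<X>>%VS -> p x = 0.
  move=> xX; apply/eqP/negPn/negP => /a_pos.
  rewrite p_orth ?ltxx//; have [xp _] := pP x.
  by rewrite -[p x](subKr x) rpredB.
have vX i : i \in recurrent v -> v i \in <<X>>%VS.
  by move=> iF; rewrite memv_span// fintype.image_f.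
have [Cu Cu0 upper] := greedy_upper_bound v a_pos.
have [Cs Cs0 spanb] := @span_norm_bound _ _ dot a mu X mu0 coer.
have indep := transient_independent (fun x => (pP x).1).
have [Cw Cw0 weight] := greedy_total_weight a_pos indep.
have [V V1 pV] := finite_upper_bound (fun i => dnorm dot (p (v i))).
pose Cl := Cs * (Cu * N).
have Cl0 : 0 <= Cl by rewrite !mulr_ge0.
pose M := N + 1 + 2 * (N * Cl).
have NCl : 0 <= N * Cl by rewrite mulr_ge0.
have M0 : 0 <= M by rewrite /M; lra.
have V0 : 0 <= V by rewrite (le_trans _ V1).
have CwM : 0 <= Cw * M * V by rewrite !mulr_ge0.
exists (1 + Cl + Cw * M * V + Cl); first lra.
move=> D z w i z0D zP.
have D0 : 0 <= D by rewrite (le_trans _ z0D)// dnorm_ge0.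
have ND0 : 0 <= N * D by rewrite mulr_ge0.
have NClD : 0 <= N * Cl * D by rewrite mulr_ge0.
have D_ND : D <= N * D by rewrite -[leLHS]mul1r ler_wpM2r.
have zP' : greedy_path a v [set: I]%SET (N * D) z w i.
  move=> k; have [zk /andP[w0 wD] sel] := zP k; split=> //.
    by rewrite w0 (le_trans wD).
  move=> /sel[iJ greedy]; split=> // j jJ.
  by rewrite (le_trans (greedy j jJ))// lerD2l.
have az0 j : `|a (z 0%N) (v j)| <= N * D.
  by rewrite (le_trans (aN j _))// ler_wpM2l.
have ell k : dnorm dot (z k - p (z k)) <= Cl * D.
  rewrite /Cl -!mulrA; apply: spanb; first by rewrite !mulr_ge0.
    exact: (pP _).1.
  move=> y /fintype.imageP[j jF ->]; rewrite linearBl/= (p_orth _ _ (vX j jF)) subr0.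
  exact: (upper (N * D) z w i).
have a_pz k j : a (p (z k)) (p (v j)) = a (z k) (v j) - a (z k - p (z k)) (v j).
  have := p_orth (z k) _ (pP (v j)).1.
  rewrite linearBr linearBl => /eqP; rewrite subr_eq0 => /eqP <-.
  by rewrite subKr.
have a_ell k j : `|a (z k - p (z k)) (v j)| <= N * Cl * D.
  by rewrite (le_trans (aN j _))// -mulrA ler_wpM2l.
pose w' k := if i k \in recurrent v then 0 else w k.
(* averaging the greedy inequality with the weights l of the origin *)
have sel_le k : w k != 0 -> a (z k) (v (i k)) <= D.
  have [_ _ sel] := zP k; move=> /sel[_ greedy].
  rewrite -[leLHS]mul1r -[leRHS]add0r.
  rewrite -(linear0r a (z k)) -lv form_sumr -{1}l1 mulr_suml.
  rewrite -[X in _ + X]mul1r -l1 mulr_suml -big_split/=; apply: ler_sum => j _.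
  by rewrite -mulrDr ler_wpM2l// greedy// finset.in_setT.
have mP : greedy_path a (p \o v) (~: recurrent v)%SET (M * D) (p \o z) w' i.
  move=> k; have [zk /andP[w0 wD] sel] := zP k.
  have MD : D <= M * D.
    by rewrite -[leLHS]mul1r ler_wpM2r// /M; lra.
  split.
  - rewrite /= zk linearD linearZ/= /w'; case: ifPn => // iF.
    by rewrite (pX _ (vX _ iF)) !scaler0.
  - by rewrite /w'; case: ifP => _; rewrite ?lexx ?w0/= (le_trans _ MD)// .
  - rewrite /w'; case: ifPn; first by rewrite eqxx.
    move=> iF /sel[_ greedy]; split; first by rewrite finset.in_setC.
    move=> j _ /=; rewrite !a_pz.
    have := greedy j (finset.in_setT j).
    have := a_ell k j; have := a_ell k (i k).
    rewrite !ler_norml /M => /andP[h1 h2] /andP[h3 h4]; lra.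
have m0 j : `|a ((p \o z) 0%N) ((p \o v) j)| <= M * D.
  rewrite /= a_pz (le_trans (ler_normB _ _))//.
  have := a_ell 0%N j; have := az0 j; rewrite /M; lra.
have m_sel k : w' k != 0 -> a ((p \o z) k) ((p \o v) (i k)) <= M * D.
  rewrite /w'; case: ifPn; first by rewrite eqxx.
  move=> iF wk; rewrite /= a_pz.
  have := sel_le k wk; have := a_ell k (i k).
  rewrite ler_norml /M => /andP[h1 h2]; lra.
have MD0 : 0 <= M * D by rewrite mulr_ge0.
have W T := weight _ _ _ _ MD0 mP m0 m_sel T.
have pz k : p (z k) = p (z 0%N) + \sum_(0 <= n < k) w' n *: p (v (i n)).
  elim: k => [|k IHk]; first by rewrite big_geq// addr0.
  have [/= -> _ _] := mP k; rewrite big_nat_recr//= addrA IHk//.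
have w'0 n : 0 <= w' n by have [_ /andP[]] := mP n.
move=> k.
have : dnorm dot (p (z 0%N)) <= D + Cl * D.
  rewrite -[p (z 0%N)](subKr (z 0%N)) (le_trans (dnormD _ _ _))// lerD//.
  by rewrite -scaleN1r dnormZ normrN normr1 mul1r.
have : dnorm dot (\sum_(0 <= n < k) w' n *: p (v (i n))) <= Cw * M * V * D.
  rewrite (le_trans (dnorm_sum _ _ _))//.
  apply: (@le_trans _ _ ((\sum_(0 <= n < k) w' n) * V)).
    rewrite mulr_suml ler_sum// => n _.
    by rewrite dnormZ ger0_norm// ler_wpM2l.
  rewrite [leRHS](_ : _ = Cw * (M * D) * V); last ring.
  by rewrite ler_wpM2r.
have := ell k; have := dnormD dot (p (z k)) (z k - p (z k)).
rewrite (addrC (p (z k))) subrK {1}pz.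
have := dnormD dot (p (z 0%N)) (\sum_(0 <= n < k) w' n *: p (v (i n))).
lra.
Qed.

(** * Rates for the averages *)

Lemma conv_hull_weights (R : realType) (E : vectType R) (U : {fset E}) x :
  conv_hull [set` U] x ->
  exists l : U -> R, [/\ forall i, 0 <= l i, \sum_i l i = 1 &
                         x = \sum_i l i *: val i].
Proof.
pose K : set E := [set x | exists l : U -> R, [/\ forall i, 0 <= l i,
  \sum_i l i = 1 & x = \sum_i l i *: val i]].
suff /(_ x) : conv_hull [set` U] `<=` K by [].
apply: smallest_sub => [y1 y2 t|y /= yU].
  rewrite !inE => -[l1 [l10 l11 ->]] [l2 [l20 l21 ->]].
  exists (fun i => t%:num * l1 i + (1 - t%:num) * l2 i); split=> [i||].
  - by rewrite addr_ge0// mulr_ge0// subr_ge0.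
  - by rewrite big_split/= -!mulr_sumr l11 l21 !mulr1 addrC subrK.
  - under [RHS]eq_bigr do rewrite scalerDl -!scalerA.
    by rewrite big_split/= -!scaler_sumr.
exists (fun i => if i == [` yU]%fset then 1 else 0); split=> [i||].
- by case: ifP.
- by rewrite -big_mkcond big_pred1_eq.
- rewrite (bigD1 [` yU]%fset)//= eqxx scale1r big1 ?addr0// => i /negbTE ->.
  by rewrite scale0r.
Qed.

Lemma uniform_state_bound (R : realType) (E : vectType R)
    (dot : {dot E for idfun}) (U : {fset E}) (A : {linear E -> E}) (mu : R) :
  U != fset0 -> conv_hull [set` U] 0 -> 0 < mu ->
  (forall x : E, mu * dnorm dot x ^+ 2 <= dot (A x) x) ->
  exists2 C : R, 1 <= C & forall (wbar B : R) (z u : nat -> E) (w : nat -> R),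
    0 <= wbar -> 0 <= B ->
    (forall k : nat,
       [/\ z k.+1 = z k + w k *: u k,
           0 <= w k <= wbar,
           u k \in U &
           dot (A (z k)) (u k) <= fset_min U (dot (A (z k))) + B]) ->
    forall k, dnorm dot (z k) <= C * (wbar + dnorm dot (z 0%N) + B).
Proof.
move=> U0 /conv_hull_weights[l [l0 l1 /esym lv]] mu0 coer.
have [C C1 CP] := @state_bound R E U dot (energy dot A) mu val l mu0 coer
  (conj l0 lv) l1.
exists C => // wbar B z u w wbar0 B0 zP.
have z0 := dnorm_ge0 dot (z 0%N).
have /choice[i iP] : forall k, exists i : U, val i = u k.
  by move=> k; have [_ _ uU _] := zP k; exists [` uU]%fset.
apply: (CP _ z w i); first lra.
move=> k; have [zk /andP[w0 wb] _ sel] := zP k; split.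
- by rewrite iP.
- by rewrite w0; lra.
- move=> _; split=> [|j _]; first by rewrite finset.in_setT.
  rewrite iP (le_trans sel)//.
  have := (fset_minP (dot (A (z k))) U0).2 _ (valP j); rewrite /=; lra.
Qed.

Lemma total_weight_telescope (R : realType) (E : vectType R)
    (z u : nat -> E) (w : nat -> R) :
  (forall k, z k.+1 = z k + w k *: u k) ->
  forall T, \sum_(0 <= k < T) w k *: u k = z T - z 0%N.
Proof.
move=> zS; elim=> [|T IHT]; first by rewrite big_geq// subrr.
by rewrite big_nat_recr//= IHT zS addrAC.
Qed.

Theorem corollary2 (R : realType) (E : vectType R) (dot : {dot E for idfun})
    (U : {fset E}) (A : {linear E -> E}) :
  U != fset0 ->
  conv_hull [set` U] 0 ->
  (exists2 mu : R, 0 < mu &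
     forall x : E, mu * dnorm dot x ^+ 2 <= dot (A x) x) ->
  exists Cw C : R, [/\ 1 <= Cw, 1 <= C &
  forall (wbar B : R) (z u : nat -> E) (w : nat -> R),
    0 <= wbar -> 0 <= B ->
    (forall k : nat,
       [/\ z k.+1 = z k + w k *: u k,
           0 <= w k <= wbar,
           u k \in U &
           dot (A (z k)) (u k) <= fset_min U (dot (A (z k))) + B]) ->
    [/\ (* the bound on the weighted averages *)
        forall T : nat, (1 <= T)%N -> 0 < total_weight w T ->
          dnorm dot (weighted_avg w u T)
            = dnorm dot (z T - z 0%N) / total_weight w T /\
          dnorm dot (z T - z 0%N) / total_weight w T
            <= (Cw * (wbar + dnorm dot (z 0%N) + B) + dnorm dot (z 0%N))
                 / total_weight w T,
        (* convergence to zero at rate O(1 / Lambda_T) *)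
        total_weight w T @[T --> \oo] --> +oo ->
          dnorm dot (weighted_avg w u T) @[T --> \oo] --> (0 : R) /\
          (fun T : nat => dnorm dot (weighted_avg w u T) : R^o)
            =O_\oo (fun T : nat => (total_weight w T)^-1 : R^o),
        (* this is an O(1 / T) bound under linear growth of Lambda_T *)
        (exists (c : R) (T0 : nat), [/\ 0 < c, (1 <= T0)%N &
           forall T : nat, (T0 <= T)%N -> c * T%:R <= total_weight w T]) ->
          (fun T : nat => dnorm dot (weighted_avg w u T) : R^o)
            =O_\oo (fun T : nat => T%:R^-1 : R^o) &
        (* the unit-weight case *)
        (forall k : nat, w k = 1) ->
          forall T : nat, (1 <= T)%N ->
            dnorm dot (T%:R^-1 *: \sum_(0 <= k < T) u k)
              <= (C * (1 + dnorm dot (z 0%N) + B) + dnorm dot (z 0%N)) / T%:R]].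
Proof.
move=> U0 conv0 [mu mu0 coer].
have [C C1 CP] := uniform_state_bound U0 conv0 mu0 coer.
exists C, C; split=> // wbar B z u w wbar0 B0 zP.
have z0 := dnorm_ge0 dot (z 0%N).
have sumE := total_weight_telescope (fun k => let: And4 e _ _ _ := zP k in e).
pose K := C * (wbar + dnorm dot (z 0%N) + B) + dnorm dot (z 0%N).
have dzB T b : dnorm dot (z T) <= b ->
    dnorm dot (z T - z 0%N) <= b + dnorm dot (z 0%N).
  move=> zb; rewrite (le_trans (dnormD _ _ _))// lerD//.
  by rewrite -scaleN1r dnormZ normrN normr1 mul1r.
have dz T : dnorm dot (z T - z 0%N) <= K by apply: dzB; exact: (CP wbar B z u w).
have K0 : 0 <= K by rewrite (le_trans (dnorm_ge0 dot (z 0%N - z 0%N))).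
have avgE T : 0 < total_weight w T ->
    dnorm dot (weighted_avg w u T) = dnorm dot (z T - z 0%N) / total_weight w T.
  move=> L0; rewrite /weighted_avg sumE dnormZ mulrC ger0_norm//.
  by rewrite invr_ge0 ltW.
have avg_le T : 0 < total_weight w T ->
    dnorm dot (weighted_avg w u T) <= K / total_weight w T.
  by move=> L0; rewrite avgE// ler_wpM2r ?invr_ge0 ?(ltW L0).
split.
- move=> T _ L0; split; first exact: avgE.
  by rewrite ler_wpM2r ?invr_ge0 ?(ltW L0).
- move=> Loo.
  have L_gt0 : \forall T \near \oo, 0 < total_weight w T.
    by move/cvgryPgt : Loo; apply.
  have Linv : (total_weight w T)^-1 @[T --> \oo] --> (0 : R).
    by apply/gtr0_cvgV0.
  split.
    apply: (@squeeze_cvgr _ _ _ _ (fun=> 0) (fun T => K * (total_weight w T)^-1)).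
    + by near=> T; rewrite dnorm_ge0/= avg_le//; near: T.
    + exact: cvg_cst.
    + by rewrite -[X in _ --> X](mulr0 K); apply: cvgMr.
  apply/eqO_exP; exists (K + 1); first by rewrite ltr_pwDr.
  near=> T; have L0 : 0 < total_weight w T by near: T.
  rewrite !ger0_norm ?dnorm_ge0 ?invr_ge0 ?(ltW L0)//.
  by rewrite (le_trans (avg_le _ L0))// ler_wpM2r ?invr_ge0 ?(ltW L0)// lerDl.
- move=> [c [T0 [c0 T01 cL]]].
  apply/eqO_exP; exists ((K + 1) / c); first by rewrite divr_gt0// ltr_pwDr.
  near=> T.
  have T0T : (T0 <= T)%N by near: T; exact: nbhs_infty_ge.
  have TR : 0 < T%:R :> R by rewrite ltr0n (leq_trans T01).
  have cT : 0 < c * T%:R by rewrite mulr_gt0.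
  have L0 : 0 < total_weight w T by rewrite (lt_le_trans cT)// cL.
  rewrite !ger0_norm ?dnorm_ge0 ?invr_ge0 ?(ltW TR)//.
  rewrite (le_trans (avg_le _ L0))// -mulrA -invfM ler_pM ?invr_ge0 ?(ltW L0)//.
    by rewrite lerDl.
  by rewrite lef_pV2 ?posrE// cL.
- move=> w1 T T1.
  have TR : 0 < T%:R :> R by rewrite ltr0n.
  have sum1 : \sum_(0 <= k < T) u k = z T - z 0%N.
    by rewrite -sumE; apply: eq_bigr => k _; rewrite w1 scale1r.
  rewrite sum1 dnormZ mulrC ger0_norm ?invr_ge0 ?(ltW TR)//.
  rewrite ler_wpM2r ?invr_ge0 ?(ltW TR)//; apply: dzB.
  apply: (CP 1 B z u w) => // k; have [zk _ uk sel] := zP k.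
  by split=> //; rewrite w1 ler01 lexx.
Unshelve. all: by end_near.
Qed.
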